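(* Let $D^d$ be the space of $\mathbb{R}^d$-valued càdlàg functions on $[0,\infty)$ with the $J_1$-topology, $D_\uparrow$ the space of non-decreasing $[0,\infty)$-valued càdlàg functions on $[0,\infty)$ with the $M_1$-topology, $C^d\subset D^d$ the continuous functions and $D_{\uparrow\uparrow}\subset D_\uparrow$ the strictly increasing ones. Then the composition map $D^d\times D_\uparrow\to D^d$, $(x,y)\mapsto x\circ y$, where the target carries the $L^1_{\mathrm{loc}}$-topology, is continuous at every point $(x,y)\in(C^d\times D_\uparrow)\cup(D^d\times D_{\uparrow\uparrow})$.
   Context: $J_1$-topology: with $\Lambda_T$ the strictly increasing continuous bijections $\lambda:[0,T]\to[0,T]$, $d^T_{J_1}(f_1,f_2)=\inf_{\lambda\in\Lambda_T}\{\sup_{t\le T}|\lambda(t)-t|\vee\sup_{t\le T}|f_1(\lambda(t))-f_2(t)|\}$ and $d_{J_1}=\int_0^\infty e^{-T}(d^T_{J_1}\wedge1)dT$. $M_1$-topology (for real-valued paths): with $\Gamma_f(T)=\{(s,z)\in[0,T]\times\mathbb{R}:z=\theta f(s-)+(1-\theta)f(s),\theta\in[0,1]\}$ and $\Pi_f(T)$ the continuous surjections $(r,u):[0,1]\to\Gamma_f(T)$ with $r(0)=0$, $r(1)=T$ (parametric representations), $d^T_{M_1}(f_1,f_2)=\inf_{(r_i,u_i)\in\Pi_{f_i}(T)}\{\sup|r_1-r_2|\vee\sup|u_1-u_2|\}$ and $d_{M_1}=\int_0^\infty e^{-T}(d^T_{M_1}\wedge1)dT$. $L^1_{\mathrm{loc}}$-topology: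 $f_n\to f$ iff $\int_0^T|f_n(t)-f(t)|dt\to0$ for every $T>0$. *)

(* Defs.v *)
From HB Require Import structures.
From mathcomp Require Import all_boot all_order all_algebra.
From mathcomp Require Import all_classical all_reals all_analysis.
Set Implicit Arguments. Unset Strict Implicit. Unset Printing Implicit Defensive.
Import Order.TTheory GRing.Theory Num.Theory.
Import numFieldNormedType.Exports.
Local Open Scope classical_set_scope.
Local Open Scope ring_scope.

Section Defs.
Variable R : realType.

(* Paths are functions on R; only their values on [0, +oo) are ever used. *)

Definition cadlag (V : normedModType R) (f : R -> V) : Prop :=
  (forall t : R, 0 <= t -> f @ at_right t --> f t) /\
  (forall t : R, 0 < t -> cvg (f @ at_left t)).

(* f(s-), with the usual convention f(0-) = f(0). *)
Definition left_lim (V : normedModType R) (f : R -> V) (s : R) : V :=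
  if s <= 0 then f s else lim (f @ at_left s).

Definition in_D (d : nat) (f : R -> 'rV[R]_d) : Prop := cadlag f.

Definition in_C (d : nat) (f : R -> 'rV[R]_d) : Prop :=
  cadlag f /\ (forall t : R, 0 < t -> {for t, continuous f}).

Definition in_Dup (f : R -> R) : Prop :=
  cadlag f /\ (forall t : R, 0 <= t -> 0 <= f t) /\
  (forall s t : R, 0 <= s -> s <= t -> f s <= f t).

Definition in_Dupup (f : R -> R) : Prop :=
  in_Dup f /\ (forall s t : R, 0 <= s -> s < t -> f s < f t).

Definition in_Lambda (T : R) (lam : R -> R) : Prop :=
  (forall s t : R, 0 <= s -> s < t -> t <= T -> lam s < lam t) /\
  {within `[0, T], continuous lam} /\
  (forall t : R, 0 <= t <= T -> 0 <= lam t <= T) /\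
  (forall u : R, 0 <= u <= T -> exists2 t : R, 0 <= t <= T & lam t = u).

Definition dJ1T (d : nat) (T : R) (f1 f2 : R -> 'rV[R]_d) : R :=
  inf [set e : R | exists lam : R -> R, in_Lambda T lam /\
        e = Num.max (sup [set `|lam t - t| | t in `[0, T]])
                    (sup [set `|f1 (lam t) - f2 t| | t in `[0, T]])].

Definition dJ1 (d : nat) (f1 f2 : R -> 'rV[R]_d) : \bar R :=
  (\int[lebesgue_measure]_(T in `[0%R, +oo[)
      (expR (- T) * Num.min (dJ1T T f1 f2) 1)%:E)%E.

Definition Gamma (f : R -> R) (T : R) : set (R * R) :=
  [set p | 0 <= p.1 <= T /\
     exists2 th : R, 0 <= th <= 1 &
       p.2 = th * left_lim f p.1 + (1 - th) * f p.1].

Definition in_Pi (f : R -> R) (T : R) (r u : R -> R) : Prop :=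
  {within `[0, 1], continuous r} /\ {within `[0, 1], continuous u} /\
  (forall s : R, 0 <= s <= 1 -> Gamma f T (r s, u s)) /\
  (forall p, Gamma f T p -> exists2 s : R, 0 <= s <= 1 & (r s, u s) = p) /\
  r 0 = 0 /\ r 1 = T.

Definition dM1T (T : R) (f1 f2 : R -> R) : R :=
  inf [set e : R | exists r1 u1 r2 u2 : R -> R,
        in_Pi f1 T r1 u1 /\ in_Pi f2 T r2 u2 /\
        e = Num.max (sup [set `|r1 s - r2 s| | s in `[0, 1]])
                    (sup [set `|u1 s - u2 s| | s in `[0, 1]])].

Definition dM1 (f1 f2 : R -> R) : \bar R :=
  (\int[lebesgue_measure]_(T in `[0%R, +oo[)
      (expR (- T) * Num.min (dM1T T f1 f2) 1)%:E)%E.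

Definition L1loc_cvg (d : nat) (fs : nat -> R -> 'rV[R]_d)
    (f : R -> 'rV[R]_d) : Prop :=
  forall T : R, 0 < T ->
    (fun n => (\int[lebesgue_measure]_(t in `[0%R, T])
                 (`|fs n t - f t|)%:E)%E) @ \oo --> 0%E.

End Defs.

(* Main.v *)
Require Import Defs.
From HB Require Import structures.
From mathcomp Require Import all_boot all_order all_algebra.
From mathcomp Require Import all_classical all_reals all_analysis.
From mathcomp Require Import measurable_realfun lra ring.
Import Order.TTheory GRing.Theory Num.Theory.
Import numFieldNormedType.Exports.
Local Open Scope classical_set_scope.
Local Open Scope ring_scope.

(* [J1]-closeness says that every value of [xs n] on a compact is close to a
   value of [x] at a nearby time, and [M1]-closeness of monotone paths squeezes
   [ys n t] between [y (t - e) - e] and [y (t + e) + e].  Hence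
   [xs n (ys n t) -> x (y t)] whenever [y] is continuous at [t] and [x] is
   continuous at [y t].  A right-continuous function has only countably many
   discontinuities, and if [y] is strictly increasing it hits those of [x] at
   countably many times only, so the convergence holds almost everywhere and
   dominated convergence applies. *)

Set Implicit Arguments.
Unset Strict Implicit.
Unset Printing Implicit Defensive.

(** * Right-continuous and càdlàg paths *)

Section right_continuity.
Context {R : realType} {V : normedModType R}.
Implicit Types (f : R -> V) (t e : R).

Lemma at_right_cvg_dist f t e : f @ at_right t --> f t -> 0 < e ->
  exists2 dl : R, 0 < dl & forall s, t <= s < t + dl -> `|f s - f t| < e.
Proof.
move=> rf e0; move/cvgrPdist_lt : rf => /(_ _ e0).
rewrite near_withinE => /nbhs_ballP[dl /= dl0 H].
exists dl => // s /andP[]; rewrite le_eqVlt => /predU1P[<- _|ts sd].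
  by rewrite subrr normr0.
rewrite distrC; apply: H => //; rewrite /ball/= ltr0_norm ?subr_lt0//.
by rewrite opprB ltrBlDl.
Qed.

Lemma at_right_dist_cvg f t :
  (forall e, 0 < e ->
    exists2 dl : R, 0 < dl & forall s, t <= s < t + dl -> `|f s - f t| < e) ->
  f @ at_right t --> f t.
Proof.
move=> H; apply/cvgrPdist_lt => e /H[dl dl0 {}H]; near=> s.
rewrite distrC; apply: H; apply/andP; split; first by near: s;
  exact: nbhs_right_ge.
by near: s; apply: nbhs_right_lt; rewrite ltrDl.
Unshelve. all: by end_near. Qed.

Lemma at_left_cvg_dist f t e l : f @ at_left t --> l -> 0 < e ->
  exists2 dl : R, 0 < dl & forall s, t - dl < s < t -> `|f s - l| < e.
Proof.
move=> /cvgrPdist_lt/[apply]; rewrite near_withinE => /nbhs_ballP[dl /= dl0 H].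
exists dl => // s /andP[sd st].
rewrite distrC; apply: H => //; rewrite /ball/= gtr0_norm ?subr_gt0//.
by rewrite ltrBlDl -ltrBlDr.
Qed.

Definition disc f : set R := [set t | 0 < t /\ ~ {for t, continuous f}].

(* A point just right of [t] has small oscillation, so the points of large
   oscillation are isolated from the right and inject into the rationals. *)
Lemma countable_disc f : (forall t, 0 <= t -> f @ at_right t --> f t) ->
  countable (disc f).
Proof.
move=> rf.
pose osc e t := exists2 dl : R, 0 < dl &
  forall s, `|t - s| < dl -> `|f t - f s| < e.
pose B (k : nat) := [set t : R | 0 < t /\ ~ osc k.+1%:R^-1 t].
apply: (@sub_countable _ _ _ (\bigcup_k B k)).
  apply: subset_card_le => t [t0 nct]; apply: contrapT => nB; apply: nct.
  apply/cvgrPdist_lt => e e0; have [k ke] : exists k : nat, k.+1%:R^-1 < e.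
    by have [k _ /(_ k (leqnn k))] := near_infty_natSinv_lt (PosNum e0);
      exists k.
  have [dl dl0 H] : osc k.+1%:R^-1 t.
    by apply: contrapT => nosc; apply: nB; exists k.
  by apply/nbhs_ballP; exists dl => //= s /H /lt_trans; exact.
apply: bigcup_countable => // k _; set e : R := k.+1%:R^-1.
have e0 : 0 < e by rewrite invr_gt0.
have H t : exists q : rat, 0 < t ->
    t < ratr q /\ forall s, t < s -> s < ratr q -> osc e s.
  have [t0|t0] := ltP 0 t; last by exists 0.
  have [dl dl0 Hdl] :=
    at_right_cvg_dist (rf t (ltW t0)) (divr_gt0 e0 (ltr0Sn _ 1)).
  have [q] : exists q : rat, ratr q \in `]t, t + dl[.
    by apply: rat_in_itvoo; rewrite ltrDl.
  rewrite in_itv/= => /andP[tq qd]; exists q => _; split=> // s ts sq.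
  exists (Num.min (s - t) (ratr q - s)).
    by rewrite lt_min !subr_gt0 ts.
  move=> u; rewrite lt_min => /andP[su us].
  have Hs : `|f s - f t| < e / 2.
    by apply: Hdl; rewrite (ltW ts) (lt_trans sq).
  have Hu : `|f u - f t| < e / 2.
    apply: Hdl; move: su us => /ltr_normlP[su1 su2] /ltr_normlP[us1 us2].
    apply/andP; split; first by lra.
    by lra.
  rewrite (splitr e); apply: le_lt_trans (ltrD Hs Hu).
  by rewrite [`|f u - _|]distrC; apply: le_trans (ler_normD _ _);
    rewrite addrA subrK.
have [q Hq] := choice H.
apply/countable_injP; exists (pickle \o q) => s t /set_mem[s0 ns] /set_mem[t0
  nt].
move=> /= /(pcan_inj pickleK) qst.
have [[sq Hs] [tq Ht]] := (Hq _ s0, Hq _ t0).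
(* If two points shared a rational, the larger one would lie between the smaller one and that
   rational, where the oscillation is small. *)
have [st|ts|//] := ltgtP s t.
- by exfalso; apply: nt; apply: Hs => //; rewrite qst.
- by exfalso; apply: ns; apply: Ht => //; rewrite -qst.
Qed.

(** Near each [t] the path stays within 1 of [f t] on the right and of its left limit on the left;
    compactness turns these local bounds into one. *)
Lemma bounded_cadlag f (T : R) : cadlag f ->
  exists M : R, forall t, 0 <= t <= T -> `|f t| <= M.
Proof.
move=> [rf lf].
have /compact_near_coveringP nc : compact `[0, T] by exact: segment_compact.
have [|M [_ HM]] := nc R +oo (fun M t => 0 <= t -> `|f t| <= M) _ _.
  move=> t /=; rewrite in_itv/= => /andP[t0 tT].
  have [dr dr0 Hr] := at_right_cvg_dist (rf t t0) ltr01.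
  (* At [t = 0] no nonnegative [s] lies to the left, so any [l] will do. *)
  have [l [dl dl0 Hl]] : exists l, exists2 dl : R, 0 < dl &
      forall s, t - dl < s < t -> 0 <= s -> `|f s - l| < 1.
    move: t0; rewrite le_eqVlt => /predU1P[t0|t0].
      exists 0, 1 => // s /andP[_ st] s0.
      by have := le_lt_trans s0 st; rewrite -t0 ltxx.
    have [dl dl0 Hl] := at_left_cvg_dist (lf t t0) ltr01.
    by exists (lim (f @ t^'-)), dl => // s st _; exact: Hl.
  exists (ball t (Num.min dr dl),
          [set M : R | Num.max `|f t| `|l| + 1 <= M]) => /=.
    split; first by apply: nbhsx_ballx; rewrite lt_min dr0.
    exact: nbhs_pinfty_ge.
  move=> [s M] /= []; rewrite /ball/= lt_min => /andP[sr sl] HM s0.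
  have near_le (v : V) :
    `|v| <= Num.max `|f t| `|l| -> `|f s - v| < 1 -> `|f s| <= M.
    move=> hv hs; apply: le_trans HM; rewrite -(subrK v (f s)).
    by rewrite (le_trans (ler_normD _ _))// addrC lerD// ltW.
  move: sr sl => /ltr_normlP[sr1 sr2] /ltr_normlP[sl1 sl2].
  have [ts|st] := leP t s.
    by apply: (near_le (f t)); rewrite ?le_max ?lexx//; apply: Hr; apply/andP;
      split; lra.
  by apply: (near_le l); rewrite ?le_max ?lexx ?orbT//; apply: Hl => //;
    apply/andP; split; lra.
exists (M + 1) => t t0T; have [/= t0 tT] := andP t0T.
by apply: (HM (M + 1)) => //=; rewrite ?ltrDl ?in_itv.
Qed.

End right_continuity.

(** * Extracting one good horizon from an integrated distance *)

(* No measurability is needed, since the integral of a nonnegative function is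
   a supremum over the simple functions below it; the distances [dJ1T] and
   [dM1T] are not known to be measurable in [T]. *)
Lemma ge0_le_integral_lower d (T : measurableType d) (R : realType)
    (mu : {measure set T -> \bar R}) (D E : set T) (f g : T -> \bar R) :
  (forall x, D x -> 0 <= f x)%E -> (forall x, E x -> 0 <= g x)%E ->
  D `<=` E -> (forall x, D x -> f x <= g x)%E ->
  (\int[mu]_(x in D) f x <= \int[mu]_(x in E) g x)%E.
Proof.
move=> f0 g0 DE fg; rewrite !ge0_integralE//.
apply: le_ereal_sup => _ [h /= hf <-]; exists h => //= x.
apply: le_trans (hf x) _; rewrite !patchE.
case: ifPn => [/set_mem Dx|_]; first by rewrite mem_set ?fg//; exact: DE.
by case: ifPn => // /set_mem/g0.
Qed.

(** If [F n] were at least [e] on all of [[S, S + 1]], the integral over this unit interval alone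
    would be at least the constant [c]. The horizon found depends on [n], which is harmless since it
    always covers [[0, S]]. *)
Lemma cvg_exp_integral_lt {R : realType} (F : nat -> R -> R) (S e : R) :
  (forall n T, 0 <= F n T) -> 0 <= S -> 0 < e ->
  (fun n => \int[lebesgue_measure]_(T in `[0%R, +oo[)
      (expR (- T) * Num.min (F n T) 1)%:E)%E @ \oo --> 0%E ->
  \forall n \near \oo, exists2 T, S <= T <= S + 1 & F n T < e.
Proof.
move=> F0 S0 e0 IF0; pose c : R := expR (- (S + 1)) * Num.min e 1.
have c0 : 0 < c by rewrite mulr_gt0 ?expR_gt0// lt_min e0 ltr01.
have : \forall n \near \oo, (\int[lebesgue_measure]_(T in `[0%R, +oo[)
    (expR (- T) * Num.min (F n T) 1)%:E < c%:E)%E.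
  by apply: (IF0 [set y | y < c%:E]%E); apply: open_ereal_lt'; rewrite lte_fin.
apply: filterS => n; apply: contraPP => nex; apply/negP; rewrite -leNgt.
have -> : c%:E = (\int[lebesgue_measure]_(T in `[S, (S + 1)%R]) cst c%:E T)%E.
  by rewrite integral_cst//= lebesgue_measure_itv/= lte_fin ltrDl ltr01 -EFinD
    addrAC subrr add0r mule1.
apply: ge0_le_integral_lower => [T _|T _|T|T] /=.
- by rewrite lee_fin ltW.
- by rewrite lee_fin mulr_ge0 ?expR_ge0// le_min F0 ler01.
- by rewrite !in_itv/= andbT => /andP[/(le_trans S0)].
- rewrite in_itv/= => ST; have /andP[_ TS] := ST;
    rewrite lee_fin ler_pM ?expR_ge0//.
  + by rewrite le_min (ltW e0) ler01.
  + by rewrite ler_expR lerN2.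
  + rewrite le_min !ge_min lexx orbT andbT; apply/orP; left.
    by rewrite leNgt; apply/negP => FT; apply: nex; exists T.
Qed.

(** * Closeness in J1 on a compact window *)

(** The bound [M] excludes the default value 0 that [sup] takes on unbounded sets, so a small
    supremum really controls the values. *)
Lemma sup_image_lt {R : realType} (A : set R) (f : R -> R) (M e s : R) :
  (forall t, A t -> f t <= M) -> sup [set f t | t in A] < e -> A s -> f s < e.
Proof.
move=> fM fe As; apply: le_lt_trans fe; apply: ub_le_sup; last by exists s.
by exists M => _ [t At <-]; exact: fM.
Qed.

Lemma sup_image_ge0 {R : realType} (A : set R) (f : R -> R) :
  (forall t, A t -> 0 <= f t) -> 0 <= sup [set f t | t in A].
Proof.
move=> f0; have [hs|/sup_out ->//] := pselect (has_sup [set f t | t in A]).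
have [[_ [t At _]] ub] := hs.
by apply: le_trans (f0 _ At) _; apply: ub_le_sup ub _ _; exists t.
Qed.

Lemma within_continuous_bounded {R : realType} (f : R -> R) (a b : R) :
  {within `[a, b], continuous f} ->
  exists M : R, forall t, a <= t <= b -> `|f t| <= M.
Proof.
move=> cf; have := continuous_compact cf (@segment_compact _ a b).
move=> /compact_bounded[M [_ HM]]; exists (M + 1) => t tab.
by apply: (HM (M + 1)); rewrite ?ltrDl//; exists t => //=; rewrite in_itv.
Qed.

(** Ensures that the infimum in [dJ1T] is not taken over the empty set. *)
Lemma in_Lambda_id {R : realType} (T : R) : in_Lambda T id.
Proof.
split=> //; split; first by apply: continuous_subspaceT => t; exact: cvg_id.
by split => // u uT; exists u.
Qed.

Lemma dJ1T_ge0 {R : realType} d T (f1 f2 : R -> 'rV[R]_d) : 0 <= dJ1T T f1 f2.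
Proof.
apply: lb_le_inf; first by eexists; exists id; split; [exact: in_Lambda_id|].
move=> _ [lam [_ ->]]; rewrite le_max; apply/orP; left.
by apply: sup_image_ge0.
Qed.

(** The time [t] is a preimage of [w] under a near-optimal time change; boundedness of càdlàg paths
    makes both suprema genuine. *)
Lemma dJ1T_lt {R : realType} d (T e : R) (f1 f2 : R -> 'rV[R]_d) :
  cadlag f1 -> cadlag f2 -> dJ1T T f1 f2 < e ->
  forall w, 0 <= w <= T ->
    exists t, [/\ 0 <= t, `|w - t| < e & `|f1 w - f2 t| < e].
Proof.
move=> c1 c2 /inf_lt[|_ [lam [lamT ->]]].
  by eexists; exists id; split; [exact: in_Lambda_id|].
rewrite gt_max => /andP[He1 He2] w wT.
have [_ [_ [lam0T /(_ _ wT)[t tT lamt]]]] := lamT.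
have tA : [set` `[0, T]] t by rewrite /= in_itv.
have [M1 HM1] := bounded_cadlag T c1.
have [M2 HM2] := bounded_cadlag T c2.
exists t; split; first by case/andP : tT.
- rewrite -lamt; apply: (sup_image_lt _ He1 tA (M := T)) => s;
    rewrite /= in_itv/= => sT.
  have /andP[s0 sT'] := sT; have /andP[ls0 lsT] := lam0T _ sT.
  by rewrite ler_norml; apply/andP; split; lra.
- rewrite -lamt; apply: (sup_image_lt _ He2 tA (M := M1 + M2)) => s;
    rewrite /= in_itv/= => sT.
  apply: le_trans (ler_normB _ _) _; apply: lerD; last exact: HM2.
  exact/HM1/lam0T.
Qed.

(** * Parametric representations of a monotone graph *)

Section parametric_representation.
Context {R : realType} (f : R -> R).
Hypothesis fup : in_Dup f.

Let f_homo s t : 0 <= s -> s <= t -> f s <= f t.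
Proof. by case: fup => _ [_]; apply. Qed.

Lemma le_left_lim w s : 0 <= w -> w < s -> f w <= left_lim f s.
Proof.
move=> w0 ws; have s0 := le_lt_trans w0 ws.
rewrite /left_lim (lt_geF s0); apply: limr_ge; first exact: fup.1.2.
near=> u; apply: f_homo => //; apply: ltW.
by near: u; exact: nbhs_left_gt.
Unshelve. all: by end_near. Qed.

Lemma left_lim_le s c : 0 < s -> (forall w, 0 <= w < s -> f w <= c) ->
  left_lim f s <= c.
Proof.
move=> s0 H; rewrite /left_lim (lt_geF s0); apply: limr_le;
  first exact: fup.1.2.
near=> u; apply: H; apply/andP; split; last by near: u; exact: nbhs_left_lt.
by near: u; apply: nbhs_left_ge.
Unshelve. all: by end_near. Qed.

Lemma left_lim_le_id s : 0 <= s -> left_lim f s <= f s.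
Proof.
rewrite le_eqVlt => /predU1P[<-|s0]; first by rewrite /left_lim lexx.
by apply: left_lim_le => // w /andP[w0 /ltW]; exact: f_homo.
Qed.

(** For a monotone path the segment over [t] is an interval, and [th] is recovered by dividing by
    the jump when the jump is nonzero. *)
Lemma GammaP T t z :
  Gamma f T (t, z) <-> 0 <= t <= T /\ left_lim f t <= z <= f t.
Proof.
split=> [[/= tT [th /andP[th0 th1] ->]]|[tT /andP[lz zf]]].
  have /andP[t0 _] := tT; have lf := left_lim_le_id t0.
  by split => //; apply/andP; split; nra.
split=> //=; have /andP[t0 _] := tT.
have [lf|lf] := eqVneq (left_lim f t) (f t).
  by exists 0; [rewrite lexx ler01|rewrite mul0r add0r subr0 mul1r; lra].
have d0 : 0 < f t - left_lim f t by rewrite subr_gt0 lt_neqAle lf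
  left_lim_le_id.
exists ((f t - z) / (f t - left_lim f t)).
  apply/andP; split; first by rewrite divr_ge0 ?subr_ge0// -subr_ge0 ltW.
  by rewrite ler_pdivrMr// mul1r lerD2l lerN2.
by field; rewrite gt_eqF.
Qed.

Variable T : R.
Hypothesis T0 : 0 < T.

(* The completed graph of a monotone path is totally ordered and is
   parametrized by the sum of its coordinates, whose inverse is [graph_time]. *)
Definition graph_sublevel v := [set t | 0 <= t <= T /\ t + f t <= v].

Definition graph_time v := sup (graph_sublevel v).

Let has_sup_sublevel v : f 0 <= v -> has_sup (graph_sublevel v).
Proof.
move=> fv; split; first by exists 0;
  rewrite /graph_sublevel/= lexx (ltW T0) add0r.
by exists T => t [/andP[]].
Qed.

Let gt_graph_time v w : f 0 <= v -> graph_time v < w -> w <= T -> v < w + f w.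
Proof.
move=> fv vw wT; rewrite ltNge; apply/negP => wv.
have : w <= graph_time v.
  apply: ub_le_sup; first exact: (has_sup_sublevel fv).2.
  split => //; rewrite wT andbT; apply: le_trans (ltW vw).
  by apply: ub_le_sup;
    [exact: (has_sup_sublevel fv).2|rewrite /graph_sublevel/= lexx (ltW T0)
      add0r].
by rewrite leNgt vw.
Qed.

Let graph_time_itv v : f 0 <= v -> 0 <= graph_time v <= T.
Proof.
move=> fv; apply/andP; split.
  by apply: ub_le_sup;
    [exact: (has_sup_sublevel fv).2|rewrite /graph_sublevel/= lexx (ltW T0)
      add0r].
by apply: ge_sup; [exact: (has_sup_sublevel fv).1|move=> t [/andP[]]].
Qed.

Let lt_graph_time v w : f 0 <= v -> 0 <= w -> w < graph_time v -> w + f w <= v.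
Proof.
move=> fv w0 wv; have [t [tT tv] wt] := sup_gt (has_sup_sublevel fv).1 wv.
by apply: le_trans tv; apply: lerD; [exact: ltW|exact/f_homo/ltW].
Qed.

(** A graph point is determined by its coordinate sum: two distinct times for the same [v] are
    refuted by evaluating the path at their midpoint. *)
Let graph_timeE v t : 0 <= t <= T -> left_lim f t <= v - t <= f t ->
  f 0 <= v -> graph_time v = t.
Proof.
move=> tT /andP[lv vf] fv; have /andP[t0 tT'] := tT.
have /andP[g0 gT] := graph_time_itv fv.
apply/eqP; rewrite eq_le; apply/andP; split; rewrite leNgt; apply/negP => H.
  have Hm : t < (t + graph_time v) / 2 by lra.
  have := @lt_graph_time v ((t + graph_time v) / 2) fv.
  have := @f_homo t ((t + graph_time v) / 2) t0 (ltW Hm).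
  by lra.
have Hm : (t + graph_time v) / 2 < t by lra.
have m0 : 0 <= (t + graph_time v) / 2 by lra.
have := @gt_graph_time v ((t + graph_time v) / 2) fv.
have := le_left_lim m0 Hm.
by lra.
Qed.

(** Since [t + f t] grows at least as fast as [t], its inverse is 1-Lipschitz. This gives continuity
    of the time coordinate. *)
Let graph_time_lip v v' : f 0 <= v -> v <= v' ->
  graph_time v <= graph_time v' <= graph_time v + (v' - v).
Proof.
move=> fv vv'; have fv' := le_trans fv vv'; apply/andP; split.
  apply: ge_sup; first exact: (has_sup_sublevel fv).1.
  move=> t [tT tv]; apply: ub_le_sup; first exact: (has_sup_sublevel fv').2.
  by split => //; exact: le_trans vv'.
rewrite leNgt; apply/negP => H.
have /andP[g0 gT] := graph_time_itv fv;
  have /andP[g0' gT'] := graph_time_itv fv'.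
(* With a third of the excess, moving both times inward by [e] leaves a gap of [v' - v + e], while
   the sums there are above [v] and at most [v']. *)
have [e eE] : exists e, 3 * e = graph_time v' - graph_time v - (v' - v).
  by exists ((graph_time v' - graph_time v - (v' - v)) / 3); lra.
have h1 : v < graph_time v + e + f (graph_time v + e).
  by apply: gt_graph_time => //; lra.
have h2 : graph_time v' - e + f (graph_time v' - e) <= v'.
  by apply: lt_graph_time => //; lra.
have h3 : f (graph_time v + e) <= f (graph_time v' - e) by apply: f_homo; lra.
by lra.
Qed.

Let graph_time_Gamma v : f 0 <= v <= T + f T ->
  Gamma f T (graph_time v, v - graph_time v).
Proof.
move=> /andP[fv vT]; have /andP[g0 gT] := graph_time_itv fv.
apply/GammaP; split; first by rewrite g0.
apply/andP; split.
  move: (g0); rewrite le_eqVlt => /predU1P[<-|gp].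
    by rewrite /left_lim lexx subr0.
  apply/ler_addgt0Pr => e e0; apply: left_lim_le => // w /andP[w0 wg].
  (* Times far below [graph_time v] are compared with the time [graph_time v - e]. *)
  have [we|ew] := leP (graph_time v - e) w.
    by have := lt_graph_time fv w0 wg; lra.
  have h : f w <= f (graph_time v - e) by apply: f_homo => //; exact: ltW.
  have := @lt_graph_time v (graph_time v - e) fv.
  by lra.
have [gT'|gT'] := ltP (graph_time v) T; last first.
  by have -> : graph_time v = T; lra.
rewrite leNgt; apply/negP => H.
pose e := v - graph_time v - f (graph_time v).
have e0 : 0 < e / 2 by rewrite /e; lra.
have [dl dl0 Hdl] := at_right_cvg_dist (fup.1.1 _ g0) e0.
(* Time and value each increase by at most [e / 2] over a step [m], so the sum stays below [v] at a
   time past [graph_time v], which is impossible. *)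
pose m := Num.min (Num.min (dl / 2) (e / 2)) (T - graph_time v).
have m0 : 0 < m by rewrite /m !lt_min; lra.
have md : m <= dl / 2 by rewrite /m !ge_min lexx.
have me : m <= e / 2 by rewrite /m !ge_min lexx orbT.
have mT : m <= T - graph_time v by rewrite /m !ge_min lexx orbT.
have /ltr_normlP[_ H1] : `|f (graph_time v + m) - f (graph_time v)| < e / 2.
  by apply: Hdl; apply/andP; split; lra.
have := @gt_graph_time v (graph_time v + m) fv.
by move: H1 me; rewrite /e; lra.
Qed.

(* Without this, [dM1T] could be the junk value [inf set0 = 0]. *)
Lemma in_Pi_exists : exists r u, in_Pi f T r u.
Proof.
have f0T : f 0 <= f T by apply: f_homo => //; exact: ltW.
(* The map [v] carries [[0, 1]] affinely onto the range of coordinate sums, from [f 0] to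
   [T + f T]. *)
pose L := T + f T - f 0; have L0 : 0 < L by rewrite /L; move: T0; lra.
pose v s := f 0 + s * L.
have fv s : 0 <= s -> f 0 <= v s by move=> s0; rewrite lerDl mulr_ge0// ltW.
have v1 : v 1 = T + f T by rewrite /v /L; lra.
have vT s : s <= 1 -> v s <= T + f T.
  by move=> s1; rewrite -v1 lerD2l ler_pM2r.
have cv : continuous v.
  by move=> s; apply: cvgD; [exact: cvg_cst|apply: cvgMl; exact: cvg_id].
have cr : {within `[0, 1], continuous (graph_time \o v)}.
  apply/subspace_continuousP => s /=; rewrite in_itv/= => /andP[s0 s1].
  apply/cvgrPdist_lt => e e0; rewrite near_withinE.
  have := cv s; move/cvgrPdist_lt => /(_ _ e0); apply: filterS => s'.
  rewrite /= in_itv/= => ss' /andP[s'0 s'1]; apply: le_lt_trans ss'.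
  have [vv|/ltW vv] := leP (v s) (v s').
    have /andP[H1 H2] := graph_time_lip (fv _ s0) vv.
    by rewrite /= !ler0_norm ?subr_le0// !opprB lerBlDl.
  have /andP[H1 H2] := graph_time_lip (fv _ s'0) vv.
  by rewrite /= !ger0_norm ?subr_ge0// lerBlDl.
exists (graph_time \o v), (fun s => v s - graph_time (v s)); split => //.
split.
  apply/subspace_continuousP => s s01.
  apply: cvgB; last by have /subspace_continuousP := cr; exact.
  by apply: cvg_within_filter; exact: cv.
split; first by move=> s /andP[s0 s1]; apply: graph_time_Gamma;
  rewrite fv//= vT.
split.
  move=> [t z] /GammaP[tT lzf]; have /andP[t0 tT'] := tT;
    have /andP[lz zf] := lzf.
  have ftT := f_homo t0 tT'.
  have tz : f 0 <= t + z.
    move: (t0); rewrite le_eqVlt => /predU1P[t00|tp].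
      by move: lz; rewrite -t00 /left_lim lexx add0r.
    by have := le_left_lim (lexx 0) tp; lra.
  exists ((t + z - f 0) / L).
    rewrite divr_ge0 ?(ltW L0) ?subr_ge0//= ler_pdivrMr// mul1r /L; lra.
  have vE : v ((t + z - f 0) / L) = t + z by rewrite /v divfK ?gt_eqF//; lra.
  have gE : graph_time (t + z) = t.
    by apply: graph_timeE => //; rewrite addrAC subrr add0r.
  by rewrite /= vE gE addrAC subrr add0r.
split=> /=.
  rewrite /v mul0r addr0; apply: graph_timeE => //;
    first by rewrite lexx (ltW T0).
  by rewrite /left_lim lexx subr0 lexx.
rewrite v1; apply: graph_timeE; first by rewrite (ltW T0) lexx.
  by rewrite addrAC subrr add0r lexx (left_lim_le_id (ltW T0)).
by move: T0; lra.
Qed.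

End parametric_representation.

Lemma countableU {T : Type} (A B : set T) :
  countable A -> countable B -> countable (A `|` B).
Proof.
move=> cA cB; rewrite -bigcup2E; apply: bigcup_countable => // -[|[|n]] _ //=.
Qed.

(** * Closeness in M1 of monotone paths *)

Lemma dM1T_ge0 {R : realType} (T : R) (f1 f2 : R -> R) : 0 <= dM1T T f1 f2.
Proof.
have [[E0 _]|/inf_out E0] := pselect (has_inf [set e : R | exists r1 u1 r2 u2,
  in_Pi f1 T r1 u1 /\ in_Pi f2 T r2 u2 /\
  e = Num.max (sup [set `|r1 s - r2 s| | s in `[0, 1]])
              (sup [set `|u1 s - u2 s| | s in `[0, 1]])]);
                last by rewrite /dM1T E0.
apply: lb_le_inf => // _ [r1 [u1 [r2 [u2 [_ [_ ->]]]]]].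
by rewrite le_max sup_image_ge0.
Qed.

(** When the first representation passes through [(t, f1 t)], the second is at a graph point of [f2]
    within [e] in both coordinates. Monotonicity bounds its height by [f2 (t + e)] above and,
    through the left limit, by [f2 (t - e)] below. *)
Lemma dM1T_lt {R : realType} (T e : R) (f1 f2 : R -> R) :
  in_Dup f1 -> in_Dup f2 -> 0 < T -> dM1T T f1 f2 < e ->
  forall t, 0 <= t <= T ->
    f1 t < f2 (t + e) + e /\ (0 <= t - e -> f2 (t - e) - e < f1 t).
Proof.
move=> up1 up2 T0 /inf_lt[|_ [r1 [u1 [r2 [u2 [P1 [P2 ->]]]]]]].
  have [[r1 [u1 P1]] [r2 [u2 P2]]] :=
    (in_Pi_exists up1 T0, in_Pi_exists up2 T0).
  by eexists; exists r1, u1, r2, u2.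
rewrite gt_max => /andP[He1 He2] t tT.
have [/within_continuous_bounded[Mr1 Hr1] [/within_continuous_bounded[Mu1 Hu1]
  [_ [surj1 _]]]] := P1.
have [/within_continuous_bounded[Mr2 Hr2] [/within_continuous_bounded[Mu2 Hu2]
  [G2 _]]] := P2.
have [|s s01 [rs us]] := surj1 (t, f1 t).
  apply/GammaP => //; split=> //; rewrite lexx andbT.
  by apply: left_lim_le_id => //; case/andP : tT.
have sA : [set` `[0, 1]] s by rewrite /= in_itv.
have /ltr_normlP[hr1 hr2] : `|r1 s - r2 s| < e.
  apply: (sup_image_lt _ He1 sA (M := Mr1 + Mr2)) => q;
    rewrite /= in_itv/= => q01.
  by apply: le_trans (ler_normB _ _) _; apply: lerD; [exact: Hr1|exact: Hr2].
have /ltr_normlP[hu1 hu2] : `|u1 s - u2 s| < e.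
  apply: (sup_image_lt _ He2 sA (M := Mu1 + Mu2)) => q;
    rewrite /= in_itv/= => q01.
  by apply: le_trans (ler_normB _ _) _; apply: lerD; [exact: Hu1|exact: Hu2].
have /(GammaP up2)[/andP[r0 rT] /andP[lu uf]] := G2 _ s01.
rewrite rs us in hr1 hr2 hu1 hu2.
split.
  have : f2 (r2 s) <= f2 (t + e) by apply: up2.2.2 => //; lra.
  by lra.
move=> te; have : f2 (t - e) <= left_lim f2 (r2 s).
  by apply: le_left_lim => //; lra.
by lra.
Qed.

(** * Right-continuity and measurability of compositions *)

Section composition.
Context {R : realType} {V : normedModType R}.
Implicit Types (f : R -> V) (t e : R).

(** Monotonicity makes [y s] approach [y t] from the right, where [f] is controlled. *)
Lemma at_right_comp f (y : R -> R) t : 0 <= t ->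
  (forall s, 0 <= s -> f @ at_right s --> f s) -> in_Dup y ->
  (f \o y) @ at_right t --> (f \o y) t.
Proof.
move=> t0 rf [[ry _] [y0 yup]]; apply: at_right_dist_cvg => e e0.
have [d1 d10 H1] := at_right_cvg_dist (rf _ (y0 _ t0)) e0.
have [d2 d20 H2] := at_right_cvg_dist (ry _ t0) d10.
exists d2 => // s /[dup] /andP[ts _] /H2 /ltr_normlP[_ yst].
by apply: H1; rewrite yup//= -ltrBlDl.
Qed.

End composition.

(** The function is continuous off a countable set, and every subset of a countable set is
    measurable. *)
Lemma measurable_right_continuous {R : realType} (h : R -> R) (T : R) :
  (forall t, 0 <= t -> h @ at_right t --> h t) ->
  measurable_fun `[0, T] h.
Proof.
(* The point 0 is added because nothing is known of [h] to its left and [disc] contains positive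
   points only. *)
move=> rh; pose C := [set 0] `|` disc h.
have cC : countable C.
  by rewrite /C; apply: countableU; [exact: countable1|exact: countable_disc].
have mC A : A `<=` C -> measurable A.
  move=> AC; apply: countable_measurable => //.
  exact: sub_countable (subset_card_le AC) cC.
have -> : `[0, T]%classic = (`[0, T] `\` C) `|` (`[0, T] `&` C).
  by rewrite setUC setUIDK.
have mD : measurable (`[0, T]%classic `\` C) by apply: measurableD => //;
  exact: mC.
have mI : measurable (`[0, T]%classic `&` C) by apply: mC; exact: subIsetr.
apply/measurable_funU => //; split.
- apply: subspace_continuous_measurable_fun => //.
  apply/subspace_continuousP => t [/=]; rewrite in_itv/= => /andP[t0 tT] nC.
  apply: cvg_within_filter; apply: contrapT => nct; apply: nC.
  move: t0; rewrite le_eqVlt => /predU1P[<-|t0]; first by left.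
  by right.
- by move=> _ Y mY; apply: mC => t [[]].
Qed.

(** * From convergence of the distances to pointwise convergence *)

Lemma dM1_cvg_near {R : realType} (y : R -> R) (ys : nat -> R -> R) (S e : R) :
  in_Dup y -> (forall n, in_Dup (ys n)) -> 0 < S -> 0 < e ->
  (fun n => dM1 (ys n) y) @ \oo --> 0%E ->
  \forall n \near \oo, forall t, 0 <= t <= S ->
    ys n t < y (t + e) + e /\ (0 <= t - e -> y (t - e) - e < ys n t).
Proof.
move=> yup ysup S0 e0.
move=> /(cvg_exp_integral_lt (fun n T => dM1T_ge0 T (ys n) y) (ltW S0) e0).
apply: filterS => n [T /andP[ST _] dT] t /andP[t0 tS].
by apply: (dM1T_lt (ysup n) yup (lt_le_trans S0 ST) dT);
  rewrite t0 (le_trans tS).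
Qed.

Lemma dJ1_cvg_near {R : realType} d (x : R -> 'rV[R]_d)
    (xs : nat -> R -> 'rV[R]_d) (S e : R) :
  cadlag x -> (forall n, cadlag (xs n)) -> 0 <= S -> 0 < e ->
  (fun n => dJ1 (xs n) x) @ \oo --> 0%E ->
  \forall n \near \oo, forall w, 0 <= w <= S ->
    exists t, [/\ 0 <= t, `|w - t| < e & `|xs n w - x t| < e].
Proof.
move=> cx cxs S0 e0.
move=> /(cvg_exp_integral_lt (fun n T => dJ1T_ge0 T (xs n) x) S0 e0).
apply: filterS => n [T /andP[ST _] dT] w /andP[w0 wS].
by apply: (dJ1T_lt (cxs n) cx dT); rewrite w0 (le_trans wS).
Qed.

Section pointwise.
Context {R : realType} {d : nat}.
Variables (x : R -> 'rV[R]_d) (y : R -> R).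
Variables (xs : nat -> R -> 'rV[R]_d) (ys : nat -> R -> R).
Hypotheses (cx : cadlag x) (yup : in_Dup y).
Hypotheses (cxs : forall n, cadlag (xs n)) (ysup : forall n, in_Dup (ys n)).
Hypothesis xsx : (fun n => dJ1 (xs n) x) @ \oo --> 0%E.
Hypothesis ysy : (fun n => dM1 (ys n) y) @ \oo --> 0%E.

Lemma dM1_cvg_at (t : R) :
  0 < t -> {for t, continuous y} -> ys ^~ t @ \oo --> y t.
Proof.
move=> t0 /cvgrPdist_lt cy; apply/cvgrPdist_lt => e e0.
have e20 : 0 < e / 2 by rewrite divr_gt0.
have /nbhs_ballP[dl /= dl0 Hdl] := cy _ e20.
(* Here [m <= t] keeps [t - m] nonnegative, which the lower squeeze requires. *)
have [m [m0 md me mt]] : exists m, [/\ 0 < m, m < dl, m <= e / 2 & m <= t].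
  exists (Num.min (Num.min (dl / 2) (e / 2)) t).
  rewrite !lt_min divr_gt0//= e20 t0 !gt_min ltr_pdivrMr// ltr_pMr// ltr1n.
  by rewrite !ge_min !lexx !orbT.
have := dM1_cvg_near yup ysup t0 m0 ysy; apply: filterS => n /(_ t).
rewrite (ltW t0) lexx => /(_ isT)[h1 h2].
have /ltr_normlP[h3 _] : `|y t - y (t + m)| < e / 2.
  by apply: Hdl; rewrite /ball/= opprD addNKr normrN gtr0_norm.
have /ltr_normlP[_ h4] : `|y t - y (t - m)| < e / 2.
  by apply: Hdl; rewrite /ball/= opprB addrCA subrr addr0 gtr0_norm.
by apply/ltr_normlP; split; lra.
Qed.

(** The value [xs n (ws n)] is close to [x] at a time near [ws n], hence near [w]. At [w = 0]
    right-continuity suffices, all times being nonnegative. *)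
Lemma dJ1_cvg_at (w : R) (ws : nat -> R) : 0 <= w -> (forall n, 0 <= ws n) ->
  (0 < w -> {for w, continuous x}) -> ws @ \oo --> w ->
  (fun n => xs n (ws n)) @ \oo --> x w.
Proof.
move=> w0 ws0 cxw wsw; apply/cvgrPdist_lt => e e0.
have e20 : 0 < e / 2 by rewrite divr_gt0.
have [dl dl0 Hdl] : exists2 dl : R, 0 < dl &
    forall s, 0 <= s -> `|w - s| < dl -> `|x w - x s| < e / 2.
  move: (w0); rewrite le_eqVlt => /predU1P[w00|wp].
    have [dl dl0 Hdl] := at_right_cvg_dist (cx.1 w w0) e20.
    exists dl => // s s0 ws_dl; rewrite distrC; apply: Hdl.
    by move: ws_dl; rewrite -w00 sub0r normrN ger0_norm// add0r s0.
  move: (cxw wp) => /cvgrPdist_lt/(_ _ e20)/nbhs_ballP[dl /= dl0 Hdl].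
  by exists dl => // s _; exact: Hdl.
pose m := Num.min (dl / 2) (e / 2).
have m0 : 0 < m by rewrite /m lt_min e20 divr_gt0.
(* The horizon [w + 1] contains [ws n] once [ws n] is within 1 of [w]. *)
have := dJ1_cvg_near cx cxs (addr_ge0 w0 ler01) m0 xsx.
have [wsd ws1] : (\forall n \near \oo, `|w - ws n| < dl / 2) /\
    (\forall n \near \oo, `|w - ws n| < 1).
  by split; move/cvgrPdist_lt : wsw; apply; rewrite ?divr_gt0.
move: wsd ws1; apply: filterS3 => n wsd ws1 /(_ (ws n)).
have [wd1 wd2] := ltr_normlP _ _ ws1.
rewrite ws0/= => /(_ _)[|t [t0 wt xt]]; first by lra.
rewrite (splitr e) -(subrK (x t) (x w)) -addrA.
apply: le_lt_trans (ler_normD _ _) _; apply: ltrD.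
  apply: Hdl => //; rewrite (splitr dl) -(subrK (ws n) w) -addrA.
  apply: le_lt_trans (ler_normD _ _) _; apply: ltrD => //.
  by apply: lt_le_trans wt _; rewrite /m ge_min lexx.
by rewrite distrC; apply: lt_le_trans xt _; rewrite /m ge_min lexx orbT.
Qed.

Lemma comp_bounded (T : R) : 0 < T ->
  exists M : R, \forall n \near \oo, forall t, 0 <= t <= T ->
    `|xs n (ys n t) - x (y t)| <= M.
Proof.
(* M1-closeness at scale 1 puts [ys n t] below [S]; J1-closeness at scale 1 then matches it with a
   time below [S + 1]. *)
move=> T0; pose S := y (T + 1) + 1.
have y0 t : 0 <= t -> 0 <= y t by exact: yup.2.1.
have S0 : 0 <= S by rewrite addr_ge0// y0//; lra.
have [M HM] := bounded_cadlag (S + 1) cx.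
exists (1 + M + M).
have := dJ1_cvg_near cx cxs S0 ltr01 xsx.
have := dM1_cvg_near yup ysup T0 ltr01 ysy.
apply: filterS2 => n Hy Hx t tT; have /andP[t0 tT'] := tT.
have yS s : 0 <= s -> s <= T + 1 -> y s + 1 <= S.
  by move=> s0 sT; rewrite lerD2r; apply: yup.2.2.
have [yn _] := Hy _ tT.
have [|s [s0 /ltr_normlP[s1 s2] xss]] := Hx (ys n t).
  rewrite (ysup n).2.1//=; apply: ltW; apply: lt_le_trans yn _.
  by apply: yS; lra.
have H1 : `|x s| <= M.
  apply: HM; rewrite s0/=; have := yS (t + 1); lra.
have H2 : `|x (y t)| <= M.
  by apply: HM; rewrite y0//=; have := yS t; lra.
apply: le_trans (ler_normB _ _) _; apply: lerD => //.
rewrite -(subrK (x s) (xs _ _)); apply: le_trans (ler_normD _ _) _.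
by apply: lerD => //; exact: ltW.
Qed.

End pointwise.

(** * Almost everywhere convergence and domination *)

Theorem theorem3p10 (R : realType) (d : nat)
  (x : R -> 'rV[R]_d) (y : R -> R) :
  in_D x -> in_Dup y -> (in_C x \/ in_Dupup y) ->
  forall (xs : nat -> R -> 'rV[R]_d) (ys : nat -> R -> R),
    (forall n, in_D (xs n)) -> (forall n, in_Dup (ys n)) ->
    (fun n => dJ1 (xs n) x) @ \oo --> 0%E ->
    (fun n => dM1 (ys n) y) @ \oo --> 0%E ->
    L1loc_cvg (fun n t => xs n (ys n t)) (fun t => x (y t)).
Proof.
move=> cx yup xy xs ys cxs ysup xsx ysy T T0.
pose h n t := `|xs n (ys n t) - x (y t)|.
have mh n : measurable_fun `[0, T] (h n).
  apply: measurable_right_continuous => t t0.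
  apply: cvg_norm; apply: cvgB.
  - exact: (at_right_comp t0 (cxs n).1 (ysup n)).
  - exact: (at_right_comp t0 cx.1 yup).
have [M] := comp_bounded cx yup cxs ysup xsx ysy T0.
move=> [N _ HN].
(* The hypothesis on the pair enters here only: [J] is empty if [x] is continuous, and [y] injects
   it into [disc x] if [y] is strictly increasing. *)
pose J := [set t | [/\ 0 <= t, 0 < y t & ~ {for y t, continuous x}]].
have cJ : countable J.
  case: xy => [[_ Cx]|[_ yinj]].
    by apply: (sub_countable _ (countable0 R));
      apply: subset_card_le => t [_ /Cx].
  have /countable_injP[g injg] := countable_disc cx.1.
  apply/countable_injP; exists (g \o y).
  move=> s t /set_mem[s0 ys0 ncs] /set_mem[t0 yt0 nct] gst.
  have yst : y s = y t by apply: injg => //; exact: mem_set.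
  by have [st|ts|//] := ltgtP s t;
    [have := yinj _ _ s0 st|have := yinj _ _ t0 ts];
    rewrite yst ltxx.
pose C := ([set 0] `|` disc y) `|` J.
have cC : countable C.
  apply: countableU => //; apply: countableU; first exact: countable1.
  exact: countable_disc yup.1.1.
have hcvg t : (`[0, T] `\` C) t -> h ^~ t @ \oo --> 0.
  move=> [/=]; rewrite in_itv/= => /andP[t0 tT] nC.
  have tp : 0 < t.
    by rewrite lt_neqAle t0 andbT; apply/eqP => t00; apply: nC; left; left.
  have cyt : {for t, continuous y}.
    by apply: contrapT => ncy; apply: nC; left; right.
  have := dM1_cvg_at yup ysup ysy tp cyt.
  move=> /(dJ1_cvg_at cx cxs xsx (yup.2.1 _ t0) (fun n => (ysup n).2.1 _ t0)).
  move=> /(_ _)/cvgrPdist_lt H.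
  apply/cvgrPdist_lt => e e0; apply: filterS (H _ e e0).
    by move=> n; rewrite /h sub0r normrN normr_id distrC.
  by move=> y0; apply: contrapT => ncx; apply: nC; right.
(* The bound [M] holds from index [N] on, while domination is required at every index. *)
rewrite -(cvg_shiftn N).
have aeC (P : R -> Prop) : (forall t, ~ C t -> P t) ->
    {ae (@lebesgue_measure R), forall t, P t}.
  move=> HP; exists C; split.
  - by apply: countable_measurable.
  - exact: countable_lebesgue_measure0.
  - by move=> t /= nP; apply: contrapT => /HP.
have [] := @dominated_convergence _ _ R (@lebesgue_measure R) `[0, T]%classic _
  (fun n t => (h (n + N)%N t)%:E) (cst 0%E) (cst M%:E).
- by [].
- by move=> n; apply/measurable_EFinP; exact: mh.
- exact: measurable_cst.
- apply: aeC => t nC tT; apply: cvg_EFin; first exact: nearW.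
  by rewrite (cvg_shiftn N (h ^~ t)); exact: hcvg.
- apply: (@continuous_compact_integrable _ (cst M)) => //;
    first exact: segment_compact.
  by apply: continuous_subspaceT => t; exact: cvg_cst.
- apply: aeC => t _ n tT; rewrite /= lee_fin normr_id.
  apply: HN; first exact: leq_addl.
  by move: tT; rewrite /= in_itv.
- by rewrite integral0.
Qed.
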